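(* Let $V^*$ be the minimum average cost of the MDP $\Delta$, and for each integer $m\ge N+1$ let $V^{(m)*}$ be the minimum average cost of the truncated MDP $\Delta^{(m)}$. Then $V^{(m)*}\to V^*$ as $m\to\infty$.
   Context: Fix $N\ge 1$ users and arrival probabilities $p_i\in(0,1]$, $i=1,\dots,N$. MDP $\Delta$. States are $\mathbf{s}=(x_1,\dots,x_N,\lambda_1,\dots,\lambda_N)$ with each $\lambda_i\in\{0,1\}$, each age $x_i\ge1$ an integer, and such that $x_i=x_j$ with $i\neq j$ is allowed only when $x_i>N$; $\mathbf{S}$ is the set of all such states. Actions are $d\in\{0,1,\dots,N\}$ ($0$: no update; $i$: user $i$ is scheduled). From $\mathbf{s}$ under action $d$, the next ages are $x_i'=(x_i+1)-x_i\mathbf{1}_{\{i=d,\ \lambda_i=1\}}$, and the next arrival vector $(\lambda_1',\dots,\lambda_N')$ has probability $\prod_{i:\lambda_i'=1}p_i\prod_{i:\lambda_i'=0}(1-p_i)$. The immediate cost is $C(\mathbf{s},d)=\sum_{i=1}^N(x_i+1)-x_d\lambda_d$, with $x_0=\lambda_0=0$. A policy $\pi$ chooses the action $D(t)$ in each slot $t=0,1,\dots$, possibly at random and depending on the history of states up to slot $t$ and actions up to slot $t-1$. Its average cost is $V(\pi)=\limsup_{T\to\infty}\frac1{T+1}E_\pi\left[\sum_{t=0}^T C(\mathbf{S}(t),D(t))\right]$, where $\mathbf{S}(t)$ is the state in slot $t$. The minimum average cost is the minimum over all policies; it does not depend on the initial state. Truncated MDP $\Delta^{(m)}$, for integer $m\geq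 N+1$. It is the same as $\Delta$ (same actions, same cost function $C(\mathbf{s},d)$, same average-cost criterion) except that the state space $\mathbf{S}^{(m)}$ consists of the states of $\mathbf{S}$ with all ages at most $m$, and the next ages are $x_i'=[(x_i+1)-x_i\mathbf{1}_{\{i=d,\ \lambda_i=1\}}]^+_m$, where $[x]^+_m=\min(x,m)$. The next arrival vector has the same distribution as in $\Delta$. *)

(* Defs.v *)
From mathcomp Require Import all_boot all_order all_algebra.
From mathcomp Require Import all_classical all_reals all_analysis.

Set Implicit Arguments.
Unset Strict Implicit.
Unset Printing Implicit Defensive.

Import Order.TTheory GRing.Theory Num.Theory.
Import numFieldNormedType.Exports.

Local Open Scope classical_set_scope.
Local Open Scope ring_scope.

Notation arrivals N := {ffun 'I_N -> bool}.

(* A pair (x, lambda); the constraints cutting out the state spaces are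
   [in_S] and [in_Sm] below, both preserved by the dynamics. *)
Notation state N := ({ffun 'I_N -> nat} * arrivals N)%type.

Definition age N (s : state N) (i : 'I_N) : nat := s.1 i.
Definition arrived N (s : state N) (i : 'I_N) : bool := s.2 i.

(* [None] is the action 0 (no update), [Some i] schedules user i. *)
Notation action N := (option 'I_N).

Definition in_S N (s : state N) : Prop :=
  (forall i, (1 <= age s i)%N) /\
  (forall i j, i != j -> age s i = age s j -> (N < age s i)%N).

Definition in_Sm N (m : nat) (s : state N) : Prop :=
  in_S s /\ forall i, (age s i <= m)%N.

Definition next_age N (s : state N) (d : action N) (i : 'I_N) : nat :=
  ((age s i).+1 - age s i * ((d == Some i) && arrived s i))%N.

(* The two MDPs differ only by the map [cap] applied to the next ages:
   the identity for Delta, and [trunc m] for Delta^(m). *)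
Definition trunc (m x : nat) : nat := minn x m.

Definition step N (cap : nat -> nat) (s : state N) (d : action N)
    (a : arrivals N) : state N :=
  ([ffun i => cap (next_age s d i)], a).

Lemma step_in_S N (s : state N) d a : in_S s -> in_S (step id s d a).
Proof.
move=> [s1 sD]; split=> [i|i j ij]; rewrite /age !ffunE /next_age.
  by case: (_ && _); rewrite ?muln1 ?muln0 ?subn0// subSnn.
have [/andP[/eqP di _]|_] := boolP (_ && _);
  have [/andP[/eqP dj _]|_] := boolP (_ && _);
  rewrite ?muln1 ?muln0 ?subn0 ?subSnn.
- by move: dj ij; rewrite di => -[->]; rewrite eqxx.
- by move=> [] e; have := s1 j; rewrite -e.
- by move=> [] e; have := s1 i; rewrite e.
- by move=> [] e; rewrite (leq_trans (sD _ _ ij e)).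
Qed.

Lemma step_in_Sm N m (s : state N) d a : (N < m)%N ->
  in_Sm m s -> in_Sm m (step (trunc m) s d a).
Proof.
move=> Nm [/(@step_in_S _ _ d a) [s1 sD] _]; split; last first.
  by move=> i; rewrite /age ffunE geq_minr.
have m0 : (0 < m)%N := leq_ltn_trans (leq0n N) Nm.
split=> [i|i j ij].
  by have := s1 i; rewrite /age !ffunE /trunc leq_min m0 andbT.
have := sD _ _ ij; rewrite /age !ffunE /trunc /minn.
case: (ltnP (next_age s d i) m) => // mi H.
by case: ltnP => // _ e; rewrite e ltnn in mi.
Qed.

Section AverageCost.
Context {R : realType} {N : nat}.
Implicit Types (cap : nat -> nat) (p : 'I_N -> R).

Definition arrival_prob p (a : arrivals N) : R :=
  (\prod_(i | a i) p i) * (\prod_(i | ~~ a i) (1 - p i)).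

Definition cost (s : state N) (d : action N) : R :=
  \sum_i (age s i).+1%:R -
  (if d is Some i then (age s i * arrived s i)%N%:R else 0).

(* [policy_prob pi h s d] is the probability of choosing d in the current
   state s after h = (S(0),D(0)), ..., (S(t-1),D(t-1)). *)
Record policy := Policy {
  policy_prob :> seq (state N * action N) -> state N -> action N -> R ;
  policy_ge0 : forall h s d, 0 <= policy_prob h s d ;
  policy_sum1 : forall h s, \sum_d policy_prob h s d = 1 }.

(* The randomness of the slots 0, ..., T is a sequence w of T+1 pairs
   (D(t), lambda(t+1)), hence ranges over a finite set; [trajectory] lists the
   resulting pairs (S(t), D(t)), and [trajectory_prob] is the probability of w
   given the past h and the current state s. *)
Fixpoint trajectory cap (s : state N) (w : seq (action N * arrivals N)) :
    seq (state N * action N) :=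
  if w is (d, a) :: w' then (s, d) :: trajectory cap (step cap s d a) w'
  else [::].

Fixpoint trajectory_prob cap p (pi : policy) (h : seq (state N * action N))
    (s : state N) (w : seq (action N * arrivals N)) : R :=
  if w is (d, a) :: w' then
    pi h s d * arrival_prob p a *
    trajectory_prob cap p pi (rcons h (s, d)) (step cap s d a) w'
  else 1.

(* E_pi[C(S(0),D(0)) + ... + C(S(T),D(T))] with S(0) = s. *)
Definition expected_total_cost cap p (pi : policy) (s : state N) (T : nat) : R :=
  \sum_(w : T.+1.-tuple (action N * arrivals N))
    trajectory_prob cap p pi [::] s w *
    \sum_(z <- trajectory cap s w) cost z.1 z.2.

(* Extended-real valued: a policy may have infinite average cost. *)
Definition average_cost cap p (pi : policy) (s : state N) : \bar R :=
  limn_esup (fun T => (T.+1%:R^-1 * expected_total_cost cap p pi s T)%:E).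

(* The minimum over all policies, written as an infimum so that it is defined
   without first proving that it is attained. *)
Definition min_average_cost cap p (s : state N) : \bar R :=
  ereal_inf (range (fun pi : policy => average_cost cap p pi s)).

End AverageCost.

Arguments policy R N : clear implicits.

(* V^*, for the initial state s. *)
Definition Vstar (R : realType) N (p : 'I_N -> R) (s : state N) : \bar R :=
  min_average_cost id p s.

(* V^(m)*, for the initial state s. *)
Definition Vmstar (R : realType) N (m : nat) (p : 'I_N -> R) (s : state N) :
    \bar R :=
  min_average_cost (trunc m) p s.

(* Main.v *)
(* The immediate cost is the sum of the untruncated next ages, so the optimal
   T-slot cost u_T is monotone in the ages and in the truncation level.  From
   any state one reaches a state dominated by a given y in S by waiting for N+1
   consecutive slots in which all users have arrivals and serving the users in
   the age order of y; hence u_T(s) <= u_T(y) + (affine function of the ages of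
   s), uniformly in T and in the truncation.

   If the minimum average cost from some y in S is below g, for Delta or for a
   truncation at least as large as m, then u_T <= g T on S^(m) for some T > 0,
   and W = min over k < T of (u_k - g k) satisfies g + W >= min_d (C + E W)
   for Delta^(m).  Such a W bounds the minimum average cost of Delta^(m) by g
   from every state.  Thus V^(m)* <= V^* for all m.  Conversely, if V^(m)* < g
   for arbitrarily large m, there is such a W for every m; after normalisation
   at a state these are locally bounded, and their lower limit as m grows
   satisfies the same inequality for Delta, which gives V^* <= g. *)
Require Import Defs.
From mathcomp Require Import all_boot all_order all_algebra.
From mathcomp Require Import all_classical all_reals all_analysis.
From mathcomp Require Import zify ring lra.
Import Order.TTheory GRing.Theory Num.Theory.
Import numFieldNormedType.Exports.
Local Open Scope classical_set_scope.
Local Open Scope ring_scope.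

(** * Ordering the users by age *)

Section Ranking.
Context {N : nat}.
Implicit Types (s : state N) (i j : 'I_N).

(** Ties in age are broken by the index, so that [rank] is injective. *)
Definition younger s i : {set 'I_N} :=
  [set j | (age s j < age s i)%N || (age s j == age s i) && (j < i)%N].

Definition rank s i : nat := #|younger s i|.

Lemma rank_lt s i : (rank s i < N)%N.
Proof.
rewrite -[X in (_ < X)%N]card_ord -cardsT; apply: proper_card.
by rewrite properT; apply/eqP => /setP/(_ i); rewrite !inE !ltnn andbF.
Qed.

Lemma rank_inj s : injective (rank s).
Proof.
have lex_lt i j : (age s i < age s j)%N || (age s i == age s j) && (i < j)%N ->
    (rank s i < rank s j)%N.
  move=> ij; apply: proper_card; apply/properP; split.
    by apply/fintype.subsetP => k; rewrite !inE; lia.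
  by exists i; rewrite !inE // !ltnn andbF.
move=> i j e; apply/val_inj/eqP; apply: contraT => ij.
have : (rank s i < rank s j)%N || (rank s j < rank s i)%N.
  have [lt|gt|eq] := ltngtP (age s i) (age s j).
  - by rewrite lex_lt ?lt.
  - by rewrite (@lex_lt j i) ?gt ?orbT.
  have [lt|gt|/eqP eq'] := ltngtP i j; last by rewrite eq' in ij.
  - by rewrite lex_lt // eq eqxx lt orbT.
  - by rewrite (@lex_lt j i) ?orbT // eq eqxx gt orbT.
by rewrite e ltnn.
Qed.

(** Either the age exceeds [N], which bounds every rank, or the younger users have distinct positive
    ages below [age s i], since ages may coincide only above [N]. *)
Lemma rank_lt_age s i : in_S s -> (rank s i < age s i)%N.
Proof.
move=> [s1 sD]; have [Ns|sN] := ltnP N (age s i).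
  exact: ltn_trans (rank_lt s i) Ns.
suff : (size [seq age s j | j <- enum (younger s i)] <= size (iota 1 (age s i).-1))%N.
  by rewrite size_map -cardE size_iota -{2}(prednK (s1 i)) ltnS.
have young j : j \in younger s i -> (age s j < age s i)%N.
  rewrite !inE => /orP[//|/andP[/eqP e ji]].
  have := sD i j; rewrite e ltnNge sN => H.
  by have : false by apply: H => //; apply/eqP => ij; rewrite ij ltnn in ji.
apply: uniq_leq_size.
  rewrite map_inj_in_uniq ?enum_uniq // => j k; rewrite !mem_enum => jy ky e.
  apply/eqP; apply/negPn/negP => jk.
  by have := sD _ _ jk e; have := young _ jy; lia.
move=> x /mapP[j]; rewrite mem_enum => /young ji ->.
by rewrite mem_iota; have := s1 j; lia.
Qed.

End Ranking.

(** * The arrival distribution *)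

Section Arrivals.
Context {R : realType} {N : nat} {p : 'I_N -> R}.
Implicit Types (a : arrivals N) (i : 'I_N).

Definition all_arrive : arrivals N := [ffun=> true].

Lemma arrival_prob_ge0 (hp : forall i, 0 < p i <= 1) a : 0 <= arrival_prob p a.
Proof.
apply: mulr_ge0; apply: prodr_ge0 => i _; have /andP[p0 p1] := hp i.
  exact: ltW.
by rewrite subr_ge0.
Qed.

Lemma sum_arrival_prob : \sum_a arrival_prob p a = 1.
Proof.
have -> : \sum_a arrival_prob p a =
    \sum_(a : arrivals N) \prod_i (if a i then p i else 1 - p i).
  apply: eq_bigr => a _; rewrite /arrival_prob [RHS](bigID (fun i => a i)) /=.
  by congr (_ * _); apply: eq_bigr => i; [|move/negbTE] => ->.
rewrite -(bigA_distr_bigA (fun i (b : bool) => if b then p i else 1 - p i)).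
by rewrite big1 // => i _; rewrite big_bool /= addrC subrK.
Qed.

Lemma all_arrive_prob_gt0 (hp : forall i, 0 < p i <= 1) :
  0 < arrival_prob p all_arrive.
Proof.
rewrite /arrival_prob [X in _ * X]big_pred0 ?mulr1; last by move=> i; rewrite ffunE.
by apply: prodr_gt0 => i _; case/andP: (hp i).
Qed.

Lemma expectation_le_all_arrive (hp : forall i, 0 < p i <= 1)
    (f : arrivals N -> R) (A B : R) :
  f all_arrive <= A -> (forall a, f a <= B) ->
  \sum_a arrival_prob p a * f a <=
    arrival_prob p all_arrive * A + (1 - arrival_prob p all_arrive) * B.
Proof.
move=> fA fB; rewrite (bigD1 all_arrive) //= lerD //.
  by rewrite ler_wpM2l ?arrival_prob_ge0.
have -> : 1 - arrival_prob p all_arrive = \sum_(a | a != all_arrive) arrival_prob p a.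
  have := sum_arrival_prob; rewrite (bigD1 all_arrive) //= => <-.
  by rewrite addrAC subrr add0r.
rewrite mulr_suml ler_sum // => a _.
by rewrite ler_wpM2l ?arrival_prob_ge0.
Qed.

End Arrivals.

(** * Finite-horizon dynamic programming *)

Section FiniteHorizon.
Context {R : realType} {N : nat}.
Context (p : 'I_N -> R) (hp : forall i, 0 < p i <= 1).
Implicit Types (s y : state N) (d : action N) (a : arrivals N) (i : 'I_N).
Implicit Types (cap : nat -> nat) (f : state N -> R) (pi : policy R N).
Implicit Types (T X : nat).

Definition q_value cap f s d : R :=
  cost s d + \sum_a arrival_prob p a * f (step cap s d a).

Definition greedy cap f s : action N :=
  [arg min_(d < None) q_value cap f s d]%O.

Lemma greedy_min cap f s d :
  q_value cap f s (greedy cap f s) <= q_value cap f s d.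
Proof. by rewrite /greedy; case: arg_minP => // d' _; apply. Qed.

(** Value iteration on states alone; [horizon_value_le_cost_to_go] relates it to randomised,
    history-dependent policies. *)
Fixpoint horizon_value cap T s : R :=
  if T is T'.+1 then
    q_value cap (horizon_value cap T') s (greedy cap (horizon_value cap T') s)
  else 0.

Lemma horizon_value_le cap T s d :
  horizon_value cap T.+1 s <= q_value cap (horizon_value cap T) s d.
Proof. exact: greedy_min. Qed.

(** In this form the cost is visibly nonnegative and monotone in the next ages. *)
Lemma cost_next_age s d : cost s d = \sum_i (next_age s d i)%:R :> R.
Proof.
have next i : (next_age s d i)%:R =
    (age s i).+1%:R - (age s i * ((d == Some i) && arrived s i))%N%:R :> R.
  by rewrite natrB //; case: (_ && _); lia.
rewrite (eq_bigr _ (fun i _ => next i)) sumrB; congr (_ - _).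
case: d {next} => [k|]; last by rewrite big1 // => i _; rewrite muln0.
rewrite (bigD1 k) //= eqxx big1 ?addr0 // => i ik.
by rewrite (_ : (Some k == Some i) = false) ?muln0 // eq_sym; apply/negbTE.
Qed.

Lemma cost_ge0 s d : 0 <= cost s d :> R.
Proof. by rewrite cost_next_age sumr_ge0. Qed.

Lemma next_age_leS s d i : (next_age s d i <= (age s i).+1)%N.
Proof. exact: leq_subr. Qed.

Lemma cost_le s d X : (forall i, (age s i <= X)%N) ->
  cost s d <= N%:R * (X%:R + 1) :> R.
Proof.
move=> sX; rewrite cost_next_age.
apply: (@le_trans _ _ (\sum_(i < N) (X%:R + 1))).
  apply: ler_sum => i _; rewrite natr1 ler_nat.
  by apply: leq_trans (next_age_leS _ _ _) _; rewrite ltnS.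
by rewrite sumr_const card_ord mulr_natl.
Qed.

Lemma age_step_le cap s d a X : (forall x, (cap x <= x)%N) ->
  (forall i, (age s i <= X)%N) -> forall i, (age (step cap s d a) i <= X.+1)%N.
Proof.
move=> capx sX i; rewrite /age ffunE.
apply: leq_trans (capx _) (leq_trans (next_age_leS _ _ _) _).
by rewrite ltnS.
Qed.

Lemma ler_q_value cap f f' s d :
  (forall a, f (step cap s d a) <= f' (step cap s d a)) ->
  q_value cap f s d <= q_value cap f' s d.
Proof.
move=> ff'; rewrite lerD2l ler_sum // => a _.
by rewrite ler_wpM2l ?arrival_prob_ge0.
Qed.

Lemma q_value_shift cap f s d (c : R) :
  q_value cap (fun x => f x + c) s d = q_value cap f s d + c.
Proof.
rewrite /q_value -[RHS]addrA; congr (_ + _).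
under eq_bigr do rewrite mulrDr.
by rewrite big_split /= -mulr_suml sum_arrival_prob mul1r.
Qed.

Lemma horizon_value_ge0 cap T s : 0 <= horizon_value cap T s.
Proof.
elim: T s => [|T IH] s //=; rewrite addr_ge0 ?cost_ge0 ?sumr_ge0 // => a _.
by rewrite mulr_ge0 ?arrival_prob_ge0.
Qed.

Lemma horizon_value_leS cap T s :
  horizon_value cap T s <= horizon_value cap T.+1 s.
Proof.
elim: T s => [|T IH] s; first exact: horizon_value_ge0.
apply: le_trans (horizon_value_le cap T s (greedy cap (horizon_value cap T.+1) s)) _.
by apply: ler_q_value => a; exact: IH.
Qed.

Lemma horizon_value_homo cap T T' s : (T <= T')%N ->
  horizon_value cap T s <= horizon_value cap T' s.
Proof.
elim: T' => [|T' IH]; first by rewrite leqn0 => /eqP ->.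
rewrite leq_eqVlt => /orP[/eqP -> //|/IH H].
exact: le_trans H (horizon_value_leS _ _ _).
Qed.

(* Fewer arrivals can be matched by idling whenever the missing update would
   have been served. *)
Lemma horizon_value_dominated cap cap' T s y :
  {homo cap : x x' / (x <= x')%N} -> (forall x, (cap x <= cap' x)%N) ->
  (forall i, (age s i <= age y i)%N) ->
  (forall i, arrived y i -> arrived s i) ->
  horizon_value cap T s <= horizon_value cap' T y.
Proof.
move=> homo caple; elim: T s y => [//|T IH] s y sy lam /=.
set d := greedy _ _ y.
pose d' := if d is Some i then if arrived y i then Some i else None else None.
apply: le_trans (horizon_value_le _ _ _ d') _.
have next i : (next_age s d' i <= next_age y d i)%N.
  rewrite /next_age /d'; have := sy i; have := lam i.
  case: d {d'} => [k|] //=; last by rewrite muln0; lia.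
  case: (boolP (arrived y k)) => [yk|/negbTE yk].
    have [[<-]|/= _] := eqP; last lia.
    by rewrite yk => /(_ isT) ->; rewrite !muln1 /=; lia.
  case: (Some k =P Some i) => [[<-]|_] /=; last lia.
  by rewrite yk; lia.
rewrite lerD ?ler_sum // => [|a _].
  by rewrite !cost_next_age ler_sum // => i _; rewrite ler_nat.
rewrite ler_wpM2l ?arrival_prob_ge0 // IH // => i.
by rewrite /age !ffunE (leq_trans (homo _ _ (next i))).
Qed.

End FiniteHorizon.

(** * Reaching a state dominated by a given one *)

Section Catching.
Context {R : realType} {N : nat}.
Context (p : 'I_N -> R) (hp : forall i, 0 < p i <= 1).
Implicit Types (s y : state N) (i : 'I_N) (cap : nat -> nat) (T X j : nat).

Notation q := (arrival_prob p all_arrive).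

(* Expected number of slots until a run of k consecutive all-arrival slots. *)
Fixpoint run_time k : R := if k is k'.+1 then (run_time k' + 1) / q else 0.

Definition catch_slope : R := N%:R * run_time N.+1.

(** The constants are such that the credit [(N X + catch_slope) * run_time N.+1] of a complete run
    equals [catch_bound X] exactly. *)
Definition catch_bound X : R := catch_slope * (X%:R + run_time N.+1).

Let q_gt0 : 0 < q := all_arrive_prob_gt0 hp.

Lemma run_time_ge0 k : 0 <= run_time k.
Proof. by elim: k => //= k IH; rewrite divr_ge0 ?(ltW q_gt0) // addr_ge0. Qed.

Lemma run_timeS k : q * run_time k.+1 = run_time k + 1.
Proof. by rewrite /= mulrCA mulfV ?mulr1 // gt_eqF. Qed.

Lemma arrival_prob_le1 a : arrival_prob p a <= 1.
Proof.
rewrite -(@sum_arrival_prob R N p) (bigD1 a) //= lerDl sumr_ge0 // => b _.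
exact: arrival_prob_ge0.
Qed.

Lemma run_time_leS k : run_time k <= run_time k.+1.
Proof.
have := run_timeS k; have := run_time_ge0 k.+1; have := arrival_prob_le1 all_arrive.
nra.
Qed.

Lemma run_time_homo k l : (k <= l)%N -> run_time k <= run_time l.
Proof.
elim: l => [|l IH]; first by rewrite leqn0 => /eqP ->.
rewrite leq_eqVlt => /orP[/eqP -> //|/IH H].
exact: le_trans H (run_time_leS _).
Qed.

Lemma catch_slope_ge0 : 0 <= catch_slope.
Proof. by rewrite mulr_ge0 ?run_time_ge0. Qed.

Lemma catch_bound_ge0 X : 0 <= catch_bound X.
Proof. by rewrite mulr_ge0 ?catch_slope_ge0 ?addr_ge0 ?run_time_ge0. Qed.

(* With k slots of the current run behind us, the expected remaining excess is
   the full one minus [(N X + slope) run_time k]. *)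
Lemma catch_step (k X : nat) (v : R) cap T s d :
  (forall i, (age s i <= X)%N) ->
  horizon_value p cap T (step cap s d all_arrive) <=
    v + (catch_bound X.+1 - (N%:R * X.+1%:R + catch_slope) * run_time k.+1) ->
  (forall a, horizon_value p cap T (step cap s d a) <= v + catch_bound X.+1) ->
  horizon_value p cap T.+1 s <=
    v + (catch_bound X - (N%:R * X%:R + catch_slope) * run_time k).
Proof.
move=> sX Hones Hall; apply: le_trans (horizon_value_le _ _ _ _ d) _.
have := @cost_le R N s d X sX.
have := @expectation_le_all_arrive R N p hp
  (fun a => horizon_value p cap T (step cap s d a)) _ _ Hones Hall.
rewrite /q_value /catch_bound => HE Hc.
apply: le_trans (lerD Hc HE) _.
have := run_timeS k; have := run_time_ge0 k; have := catch_slope_ge0.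
move: (run_time k.+1) (run_time k) => rS r; move: (run_time N.+1) => e.
move: catch_slope => al al0 r0 qr.
have N0 : 0 <= N%:R :> R by [].
rewrite -natr1; move: (X%:R) => x.
have -> : q * (v + (al * (x + 1 + e) - (N%:R * (x + 1) + al) * rS)) +
    (1 - q) * (v + al * (x + 1 + e)) =
    v + al * (x + 1 + e) - (N%:R * (x + 1) + al) * (q * rS) by ring.
(* As [q * rS = r + 1], the extra [N (x + 1) + al] pays for the cost of this slot and for the growth
   of [catch_bound] from [X] to [X + 1]; the slack is [N r]. *)
rewrite qr; nra.
Qed.

(* The users are served in the order of decreasing ranks of [y], so that after
   a run of arrivals every user [i] has age at most [rank y i + 1]. *)
Lemma horizon_value_catch_run cap T0 y v :
  {homo cap : x x' / (x <= x')%N} -> (forall x, (cap x <= x)%N) ->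
  in_S y ->
  0 <= v ->
  (forall T, (T <= T0)%N -> horizon_value p cap T y <= v) ->
  (forall T X s, (T < T0)%N -> (forall i, (age s i <= X)%N) ->
     horizon_value p cap T s <= v + catch_bound X) ->
  forall j T X s, (j <= N)%N -> (T <= T0)%N ->
  (forall i, (age s i <= X)%N) -> (forall i, arrived s i) ->
  (forall i, (j <= rank y i)%N -> (age s i <= (rank y i).+1 - j)%N) ->
  horizon_value p cap T s <=
    v + (catch_bound X - (N%:R * X%:R + catch_slope) * run_time (N.+1 - j)).
Proof.
move=> homo caple yS v0 Hy Hs; elim=> [|j IH] T X s jN TT0 sX sones srank.
  (* Here [j] counts the ranks still to be served. At [0] the run is complete: the excess vanishes,
     and [y] dominates [s] because [rank y i < age y i]. *)
  have -> : v + (catch_bound X - (N%:R * X%:R + catch_slope) * run_time (N.+1 - 0)) = v.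
    by rewrite subn0 /catch_bound /catch_slope; ring.
  apply: le_trans (Hy _ TT0); apply: horizon_value_dominated => // i.
  by have := srank i (leq0n _); rewrite subn0 => H; apply: leq_trans H (rank_lt_age y i yS).
(* If the horizon ends during the run, the value is zero and the bound is nonnegative, the credit
   being at most that of a complete run. *)
case: T TT0 => [|T] TT0.
  have H : run_time (N.+1 - j.+1) <= run_time N.+1 by apply: run_time_homo; lia.
  have N0 : 0 <= N%:R :> R by []. have X0 : 0 <= X%:R :> R by [].
  have al0 := catch_slope_ge0.
  have : (N%:R * X%:R + catch_slope) * run_time (N.+1 - j.+1) <= catch_bound X.
    apply: le_trans (ler_wpM2l _ H) _; first by apply: addr_ge0 => //; exact: mulr_ge0.
    by rewrite /catch_bound /catch_slope; lra.
  rewrite /=; lra.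
pose d := [pick i | rank y i == j].
apply: (@catch_step _ _ _ _ _ _ d) => //.
  have -> : (N.+1 - j.+1).+1 = (N.+1 - j)%N by lia.
  apply: IH => [||i|i|i ji]; [lia|lia|exact: age_step_le| |].
    by rewrite /arrived ffunE.
  rewrite /age ffunE; apply: leq_trans (caple _) _.
  move: ji; rewrite leq_eqVlt => /orP[/eqP ji|ji]; last first.
    apply: leq_trans (next_age_leS _ _ _) _.
    by have := srank i ji; lia.
  rewrite /next_age sones andbT /d.
  case: pickP => [k /eqP kj|/(_ i)]; last by rewrite ji eqxx.
  have -> : k = i by apply: (@rank_inj _ y); rewrite kj.
  by rewrite eqxx /= muln1 -ji; lia.
(* Any other arrival vector may break the run; the full bound is then used at a shorter horizon. *)
move=> a; apply: Hs; first lia.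
exact: age_step_le.
Qed.

(** By strong induction on [T]: each attempt at a run consumes a slot, so after a failure the
    statement applies to a shorter horizon and a larger [X]. *)
Lemma horizon_value_catch cap T y s X :
  {homo cap : x x' / (x <= x')%N} -> (forall x, (cap x <= x)%N) ->
  in_S y -> (forall i, (age s i <= X)%N) ->
  horizon_value p cap T s <= horizon_value p cap T y + catch_bound X.
Proof.
move=> homo caple yS; elim/ltn_ind: T X s => -[|T] IH X s sX.
  by rewrite add0r catch_bound_ge0.
have -> : catch_bound X = catch_bound X - (N%:R * X%:R + catch_slope) * run_time 0.
  by rewrite mulr0 subr0.
have Hall T' X' s' : (T' < T.+1)%N -> (forall i, (age s' i <= X')%N) ->
    horizon_value p cap T' s' <= horizon_value p cap T.+1 y + catch_bound X'.
  move=> TT sX'; apply: le_trans (IH _ TT _ _ sX') _.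
  by rewrite lerD2r horizon_value_homo // ltnW.
(* One idle slot followed by arrivals for all users opens the run, and [N] slots of service follow:
   hence [run_time N.+1]. *)
apply: (@catch_step _ _ _ _ _ _ None) => // [|a].
  have -> : 1%N = (N.+1 - N)%N by lia.
  apply: (@horizon_value_catch_run cap T y) => //.
  - exact: horizon_value_ge0.
  - by move=> T' TT'; apply: horizon_value_homo => //; lia.
  - by move=> T' X' s' TT'; apply: Hall; lia.
  - exact: age_step_le.
  - by move=> i; rewrite /arrived ffunE.
  - by move=> i; have := rank_lt y i; lia.
by apply: Hall => //; exact: age_step_le.
Qed.

End Catching.

(** * Sums over tuples, split at the first entry *)

Lemma sum_tuple0 (V : nmodType) (X : finType) (F : seq X -> V) :
  \sum_(w : 0.-tuple X) F w = F [::].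
Proof. by rewrite (big_pred1 [tuple]) // => w; apply/esym/eqP; exact: tuple0. Qed.

Lemma sum_tuple_cons (V : nmodType) (X : finType) n (F : seq X -> V) :
  \sum_(w : n.+1.-tuple X) F w = \sum_x \sum_(w : n.-tuple X) F (x :: w).
Proof.
rewrite pair_big /=.
rewrite (reindex (fun z : X * n.-tuple X => [tuple of z.1 :: z.2])) //=.
exists (fun w : n.+1.-tuple X => (thead w, [tuple of behead w])) => [[x w] _|w _] /=.
  by congr (_, _); apply: val_inj.
by rewrite -tuple_eta.
Qed.

Lemma sum_tuple_cons_pair (V : nmodType) (X Y : finType) n (F : seq (X * Y) -> V) :
  \sum_(w : n.+1.-tuple (X * Y)) F w =
    \sum_x \sum_y \sum_(w : n.-tuple (X * Y)) F ((x, y) :: w).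
Proof. by rewrite sum_tuple_cons [RHS]pair_bigA /=; apply: eq_bigr => -[]. Qed.

(** * Policies and their average cost *)

Section Policies.
Context {R : realType} {N : nat}.
Context (p : 'I_N -> R) (hp : forall i, 0 < p i <= 1).
Implicit Types (s : state N) (d : action N) (a : arrivals N).
Implicit Types (cap : nat -> nat) (pi : policy R N) (f : state N -> R).
Implicit Types (h : seq (state N * action N)) (T : nat).

(** Generalises [expected_total_cost] to an arbitrary past, for induction; the latter at [T] is this
    at [T.+1] with empty past. *)
Definition cost_to_go cap pi h s T : R :=
  \sum_(w : T.-tuple (action N * arrivals N))
    trajectory_prob cap p pi h s w * \sum_(z <- trajectory cap s w) cost z.1 z.2.

Lemma cost_to_go0 cap pi h s : cost_to_go cap pi h s 0 = 0.
Proof.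
rewrite /cost_to_go (sum_tuple0 _ _ (fun w =>
  trajectory_prob cap p pi h s w * \sum_(z <- trajectory cap s w) cost z.1 z.2)).
by rewrite big_nil mulr0.
Qed.

Lemma sum_trajectory_prob cap pi h s T :
  \sum_(w : T.-tuple (action N * arrivals N)) trajectory_prob cap p pi h s w = 1.
Proof.
elim: T h s => [|T IH] h s.
  by rewrite (sum_tuple0 _ _ (trajectory_prob cap p pi h s)).
rewrite (sum_tuple_cons_pair _ _ _ T (trajectory_prob cap p pi h s)).
rewrite -(policy_sum1 pi h s) /=.
apply: eq_bigr => d _; rewrite -[RHS]mulr1 -(@sum_arrival_prob R N p) mulr_sumr.
by apply: eq_bigr => a _; rewrite -mulr_sumr IH mulr1.
Qed.

Lemma cost_to_goS cap pi h s T :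
  cost_to_go cap pi h s T.+1 = \sum_d pi h s d * (cost s d +
    \sum_a arrival_prob p a * cost_to_go cap pi (rcons h (s, d)) (step cap s d a) T).
Proof.
rewrite /cost_to_go (sum_tuple_cons_pair _ _ _ T (fun w =>
  trajectory_prob cap p pi h s w * \sum_(z <- trajectory cap s w) cost z.1 z.2)).
apply: eq_bigr => d _.
rewrite -[X in X + _]mul1r -(@sum_arrival_prob R N p) mulr_suml -big_split /= mulr_sumr.
apply: eq_bigr => a _; rewrite -mulrDr mulrA.
have -> : cost s d = \sum_(w : T.-tuple (action N * arrivals N))
    trajectory_prob cap p pi (rcons h (s, d)) (step cap s d a) w * cost s d :> R.
  by rewrite -mulr_suml sum_trajectory_prob mul1r.
rewrite -big_split mulr_sumr; apply: eq_bigr => w _ /=.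
by rewrite big_cons /= -mulrDr mulrA.
Qed.

(** Whatever the past, a randomised choice averages over actions, each costing at least the
    minimum. *)
Lemma horizon_value_le_cost_to_go cap pi h s T :
  horizon_value p cap T s <= cost_to_go cap pi h s T.
Proof.
elim: T h s => [|T IH] h s.
  by rewrite cost_to_go0.
rewrite cost_to_goS -[leLHS]mul1r -(policy_sum1 pi h s) mulr_suml.
apply: ler_sum => d _; rewrite ler_wpM2l ?policy_ge0 //.
apply: le_trans (horizon_value_le _ _ _ _ d) _.
rewrite lerD2l ler_sum // => a _.
by rewrite ler_wpM2l ?arrival_prob_ge0.
Qed.

Lemma horizon_value_le_expected cap pi s T :
  horizon_value p cap T.+1 s <= expected_total_cost cap p pi s T.
Proof. exact: horizon_value_le_cost_to_go. Qed.

Definition stationary_prob (delta : state N -> action N)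
  (_ : seq (state N * action N)) s d : R := (d == delta s)%:R.

Lemma stationary_prob_ge0 delta h s d : 0 <= stationary_prob delta h s d.
Proof. exact: ler0n. Qed.

Lemma stationary_prob_sum1 delta h s : \sum_d stationary_prob delta h s d = 1.
Proof.
rewrite (bigD1 (delta s)) //= /stationary_prob eqxx big1 ?addr0 // => d.
by move=> /negbTE ->.
Qed.

Definition stationary delta : policy R N :=
  Policy (stationary_prob_ge0 delta) (stationary_prob_sum1 delta).

(** The one-step inequality telescopes and leaves [- f] at the final state, which [B] bounds. *)
Lemma cost_to_go_stationary (I : state N -> Prop) cap delta f (g B : R) h s T :
  (forall s d a, I s -> I (step cap s d a)) ->
  (forall s, I s -> q_value p cap f s (delta s) <= g + f s) ->
  (forall s, I s -> - B <= f s) ->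
  I s -> cost_to_go cap (stationary delta) h s T <= g * T%:R + f s + B.
Proof.
move=> Istep Hg HB; elim: T h s => [|T IH] h s Is.
  by rewrite cost_to_go0 mulr0; have := HB _ Is; lra.
rewrite cost_to_goS (bigD1 (delta s)) //= /stationary_prob eqxx mul1r.
rewrite [X in _ + X]big1 ?addr0; last by move=> d /negbTE ->; rewrite mul0r.
apply: (@le_trans _ _ (q_value p cap (fun x => f x + (g * T%:R + B)) s (delta s))).
  rewrite lerD2l ler_sum // => a _; rewrite ler_wpM2l ?arrival_prob_ge0 //.
  by rewrite addrCA addrA IH //; exact: Istep.
rewrite q_value_shift; have := Hg _ Is; rewrite -natr1; lra.
Qed.

Lemma average_cost_lt_near cap pi s (g : R) :
  (average_cost cap p pi s < g%:E)%E ->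
  exists2 g' : R, g' < g &
    \forall T \near \oo, T.+1%:R^-1 * expected_total_cost cap p pi s T <= g'.
Proof.
rewrite /average_cost /limn_esup /limf_esup => /ereal_inf_lt[_ [A Aoo <-] Alt].
set S := ereal_sup _ in Alt.
have [g' g'g Sg'] : exists2 g' : R, g' < g & (S <= g'%:E)%E.
  (* If the tail supremum is minus infinity, any real below [g] serves. *)
  case: S Alt => [r|//|_]; first by rewrite lte_fin => rg; exists r.
  by exists (g - 1); [lra|rewrite leNye].
exists g' => //; apply: filterS Aoo => T AT; rewrite -lee_fin.
by apply: le_trans Sg'; apply: ereal_sup_ubound; exists T.
Qed.

Lemma average_cost_le cap pi s (g c : R) :
  (forall T, expected_total_cost cap p pi s T <= g * T.+1%:R + c) ->
  (average_cost cap p pi s <= g%:E)%E.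
Proof.
move=> Hc; apply/lee_addgt0Pr => e e0; rewrite -EFinD.
rewrite /average_cost /limn_esup /limf_esup; apply: ereal_inf_le.
have [n cn] : exists n : nat, `|c| / e <= n%:R.
  by exists (Num.bound (`|c| / e)); apply/ltW/archi_boundP; rewrite divr_ge0 // ltW.
eexists; first by exists [set T | (n <= T)%N] => //; exact: nbhs_infty_ge.
apply: ge_ereal_sup => _ [T /= nT <-]; rewrite lee_fin.
rewrite mulrC ler_pdivrMr ?ltr0n // mulrDl (le_trans (Hc T)) // lerD2l.
apply: le_trans (ler_norm _) _; rewrite mulrC -ler_pdivrMr //.
by apply: le_trans cn _; rewrite ler_nat; lia.
Qed.

Lemma min_average_cost_le (I : state N -> Prop) cap f (g B : R) s :
  (forall s d a, I s -> I (step cap s d a)) ->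
  (forall s, I s -> exists d, q_value p cap f s d <= g + f s) ->
  (forall s, I s -> - B <= f s) ->
  I s -> (min_average_cost cap p s <= g%:E)%E.
Proof.
move=> Istep Hg HB Is.
apply: le_trans (ereal_inf_lbound _) _.
  by exists (stationary (greedy p cap f)).
apply: (@average_cost_le _ _ _ _ (f s + B)) => T; rewrite addrA.
apply: (cost_to_go_stationary I) => // x /Hg[d]; apply: le_trans.
exact: greedy_min.
Qed.

End Policies.

(** * Supersolutions of the truncated problems *)

Section Supersolutions.
Context {R : realType} {N : nat}.
Context (p : 'I_N -> R) (hp : forall i, 0 < p i <= 1).
Implicit Types (s y : state N) (d : action N) (cap : nat -> nat) (g : R).
Implicit Types (W f : state N -> R) (m T X : nat).

Lemma trunc_homo m : {homo trunc m : x x' / (x <= x')%N}.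
Proof. by move=> x x' xx'; rewrite /trunc leq_min geq_minr andbT geq_min xx'. Qed.

Lemma trunc_le m x : (trunc m x <= x)%N.
Proof. exact: geq_minl. Qed.

(* The second clause bounds [W] from both sides uniformly in the truncation. *)
Definition supersolution m g W : Prop :=
  (forall s, (forall i, (age s i <= m)%N) ->
     exists d, q_value p (trunc m) W s d <= g + W s) /\
  (forall y s X, in_S y -> (forall i, (age s i <= X)%N) ->
     W s <= W y + catch_bound p X).

(* Take the minimum over [k <= T] of the value of horizon [k] minus [g k]: the
   term [k = 0] is dominated by the term [k = T + 1], so the minimum is at
   least the one over [1 <= k <= T + 1]. *)
Lemma supersolution_of_slow_growth m g T :
  (forall s, (forall i, (age s i <= m)%N) ->
     horizon_value p (trunc m) T.+1 s <= g * T.+1%:R) ->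
  exists W, supersolution m g W.
Proof.
move=> slow; pose F k s := horizon_value p (trunc m) k s - g * k%:R.
pose K s : 'I_T.+1 := [arg min_(k < ord0) F k s]%O.
pose W s := F (K s) s.
have WF k s : (k <= T)%N -> W s <= F k s.
  rewrite -ltnS => kT; rewrite /W /K; case: arg_minP => // k' _.
  by move=> /(_ (Ordinal kT)); apply.
have qW k s : (k <= T)%N -> exists d, q_value p (trunc m) W s d <= g + F k.+1 s.
  move=> kT; exists (greedy p (trunc m) (horizon_value p (trunc m) k) s).
  apply: (@le_trans _ _ (q_value p (trunc m)
    (fun x => horizon_value p (trunc m) k x + - (g * k%:R)) s
    (greedy p (trunc m) (horizon_value p (trunc m) k) s))).
    by apply: ler_q_value => // a; exact: WF.
  by rewrite q_value_shift /F /= -natr1; lra.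
exists W; split => [s sm|y s X yS sX].
  have [k0|k0] := posnP (K s).
    have [d Hd] := qW T s (leqnn T); exists d; apply: le_trans Hd _.
    rewrite lerD2l /W k0 /F mulr0 subr0 [X in _ <= X]/= subr_le0.
    exact: slow.
  have [|d Hd] := qW (K s).-1 s; first by have := ltn_ord (K s); lia.
  by exists d; rewrite prednK in Hd.
have KT : (K y <= T)%N by have := ltn_ord (K y); lia.
apply: le_trans (WF _ _ KT) _; rewrite /W /F.
have := horizon_value_catch p hp (trunc m) (K y) y s X (@trunc_homo m) (trunc_le m) yS sX.
lra.
Qed.

Lemma supersolution_of_min_average_cost cap m g y :
  (forall x, (trunc m x <= cap x)%N) -> in_S y ->
  (min_average_cost cap p y < g%:E)%E -> exists W, supersolution m g W.
Proof.
move=> mcap yS /ereal_inf_lt[_ [pi _ <-]] /average_cost_lt_near[g' g'g near_g'].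
have gg' : 0 < g - g' by rewrite subr_gt0.
have cb0 := catch_bound_ge0 p hp m.
have [n n_ge] : exists n : nat, catch_bound p m / (g - g') <= n%:R.
  by eexists; apply/ltW/archi_boundP; rewrite divr_ge0 // ltW.
(* [T >= M] brings the average cost from [y] below [g']; [T >= n] lets the gap [(g - g') * T.+1]
   absorb the cost [catch_bound p m] of moving to any state with ages at most [m]. *)
case: near_g' => M _ HM; set T := maxn M n.
apply: (@supersolution_of_slow_growth m g T) => s sm.
apply: le_trans (horizon_value_catch p hp (trunc m) T.+1 y s m (@trunc_homo m)
  (trunc_le m) yS sm) _.
apply: (@le_trans _ _ (g' * T.+1%:R + catch_bound p m)).
  rewrite lerD2r -ler_pdivrMr // mulrC.
  apply: le_trans (HM T (leq_maxl _ _)); rewrite ler_wpM2l //.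
  apply: le_trans (horizon_value_le_expected p hp cap pi y T).
  by apply: horizon_value_dominated => //; exact: trunc_homo.
rewrite addrC -lerBrDr -mulrBl mulrC -ler_pdivrMr //; apply: le_trans n_ge _.
by rewrite ler_nat (leq_trans (leq_maxr M n)).
Qed.

Lemma Vmstar_le_of_supersolution m g W s : (N < m)%N -> in_Sm m s ->
  supersolution m g W -> (Vmstar m p s <= g%:E)%E.
Proof.
move=> Nm sm [HW HWb].
(* The lower bound on [W] comes from catching each state [x] of the truncated space from the fixed
   [s]. *)
apply: (@min_average_cost_le _ _ _ hp (in_Sm m) _ W g
  (catch_bound p m - W s)) => // [x d a|x [_ xm]|x [xS _]].
- exact: step_in_Sm.
- exact: HW.
- by have := HWb x s m xS sm.2; lra.
Qed.

Lemma q_value_trunc m f s d : (forall i, (age s i < m)%N) ->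
  q_value p (trunc m) f s d = q_value p id f s d.
Proof.
move=> sm; rewrite /q_value; congr (_ + _); apply: eq_bigr => a _.
congr (_ * f (_, _)); apply/ffunP => i; rewrite !ffunE.
by apply/minn_idPl/(leq_trans (next_age_leS _ _ _)).
Qed.

Lemma q_value_cvg cap (F : nat -> state N -> R) f s d :
  (forall a, F n (step cap s d a) @[n --> \oo] --> f (step cap s d a)) ->
  q_value p cap (F n) s d @[n --> \oo] --> q_value p cap f s d.
Proof.
move=> Ff; apply: cvgD; first exact: cvg_cst.
by apply: cvg_big => [|a _]; [exact: add_continuous|apply: cvgM (cvg_cst _) _].
Qed.

End Supersolutions.

(** * Passage to the limit in the truncation *)

Section Untruncated.
Context {R : realType} {N : nat}.
Context (p : 'I_N -> R) (hp : forall i, 0 < p i <= 1).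
Implicit Types (s y : state N) (d : action N) (g : R) (m n k X : nat).

Definition max_age s : nat := \max_i age s i.

Lemma age_le_max s i : (age s i <= max_age s)%N.
Proof. exact: leq_bigmax. Qed.

(* Normalised at [s], the supersolutions [W n] are bounded at every state
   uniformly in [n]; the supersolution of Delta is their lower limit. *)
Lemma Vstar_le_of_supersolutions g s (W : nat -> state N -> R) : in_S s ->
  (forall n, supersolution p (n + N.+1) g (W n)) -> (Vstar p s <= g%:E)%E.
Proof.
move=> sS HW; pose h n y : R := W n y - W n s.
pose B := catch_bound p (max_age s).
have hge y n : in_S y -> - B <= h n y.
  by move=> yS; have := (HW n).2 y s _ yS (age_le_max s); rewrite /h /B; lra.
have hle y n : h n y <= catch_bound p (max_age y).
  by have := (HW n).2 s y _ sS (age_le_max y); rewrite /h; lra.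
have lbh y : in_S y -> has_lbound (range (h^~ y)).
  by move=> yS; exists (- B) => _ [n _ <-]; exact: hge.
have ubh y : has_ubound (range (h^~ y)).
  by exists (catch_bound p (max_age y)) => _ [n _ <-]; exact: hle.
pose H n y := infs (h^~ y) n.
pose f y := sup (range (H^~ y)).
have Hh y n k : in_S y -> (n <= k)%N -> H n y <= h k y.
  move=> yS nk; apply: ge_inf; last by exists k.
  by exists (- B) => _ [j _ <-]; exact: hge.
have Hcvg y : in_S y -> H n y @[n --> \oo] --> f y.
  by move=> yS; apply: cvg_infs_sup; [exact: ubh|exact: lbh].
have Hf y n : in_S y -> H n y <= f y.
  move=> yS; apply: ub_le_sup; last by exists n.
  exists (catch_bound p (max_age y)) => _ [k _ <-].
  exact: le_trans (Hh _ _ _ yS (leqnn k)) (hle _ _).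
have fge y : in_S y -> - B <= f y.
  move=> yS; apply: le_trans (Hf y 0 yS); apply: lb_le_inf.
    by exists (h 0 y), 0%N.
  by move=> _ [j _ <-]; exact: hge.
have qH y n : in_S y -> (max_age y <= n)%N ->
    exists d, q_value p id (H n) y d <= g + f y.
  (* This action does not depend on [k]. As [H n] lies below every [h k] with [k >= n], it gives the
     bound [g + h k y] for all these [k], hence [g + H n y] by taking the infimum. *)
  move=> yS yn; exists (greedy p id (H n) y).
  apply: (@le_trans _ _ (g + H n y)); last by rewrite lerD2l Hf.
  rewrite -lerBlDl; apply: lb_le_inf; first by exists (h n y), n => //=.
  move=> _ [k /= nk <-]; rewrite lerBlDl.
  have [|d Hd] := (HW k).1 y.
    by move=> i; apply: leq_trans (age_le_max y i) _; lia.
  apply: le_trans (greedy_min p id (H n) y d) _.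
  apply: (@le_trans _ _ (q_value p id (fun x => W k x + - W k s) y d)).
    by apply: ler_q_value => // a; apply: Hh => //; exact: step_in_S.
  rewrite q_value_shift -(@q_value_trunc _ _ _ (k + N.+1)); first by rewrite /h; lra.
  by move=> i; apply: leq_ltn_trans (age_le_max y i) _; lia.
apply: (@min_average_cost_le R N p hp (@in_S N) id f g B s) => // [y d a|y yS].
  exact: step_in_S.
(* There are finitely many actions: if all failed strictly for [f], all would fail for [H n] with
   [n] large, contradicting [qH]. *)
apply: contrapT => no_d.
have lim_gt d : g + f y < q_value p id f y d.
  by rewrite ltNge; apply/negP => Hd; apply: no_d; exists d.
have : \forall n \near \oo, forall d, g + f y < q_value p id (H n) y d.
  apply: filter_forall => d; apply: (cvgr_gt (q_value p id f y d)) => //.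
  by apply: q_value_cvg => a; apply: Hcvg; exact: step_in_S.
case=> M _ HM; pose n := maxn M (max_age y).
have [d] := qH y n yS (leq_maxr _ _).
by rewrite leNgt (HM n (leq_maxl _ _)).
Qed.

End Untruncated.

(** * Convergence in the extended reals and conclusion *)

Lemma ereal_dense_EFin (R : realType) (x y : \bar R) : (x < y)%E ->
  exists2 r : R, (x < r%:E)%E & (r%:E < y)%E.
Proof.
case: x y => [x||] [y||] //= => [xy|_|_|_].
- by exists ((x + y) / 2); move: xy; rewrite !lte_fin => xy; lra.
- by exists (x + 1); rewrite ?ltry // lte_fin; lra.
- by exists (y - 1); rewrite ?ltNyr // lte_fin; lra.
- by exists 0; rewrite ?ltNyr ?ltry.
Qed.

Lemma cvg_ereal_between (R : realType) (u : nat -> \bar R) (l : \bar R) :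
  (\forall n \near \oo, (u n <= l)%E) ->
  (forall r : R, (r%:E < l)%E -> \forall n \near \oo, (r%:E <= u n)%E) ->
  u n @[n --> \oo] --> l.
Proof.
move=> ul lu; case: l ul lu => [l||] ul lu.
- apply/fine_cvgP; split.
    have := lu (l - 1); rewrite lte_fin gtrBl ltr01 => /(_ isT) lu1.
    near=> n; rewrite fin_numElt; apply/andP; split.
      by apply: lt_le_trans (ltNyr (l - 1)) _; near: n.
    by apply: le_lt_trans (ltry l); near: n.
  apply/cvgrPdist_le => e e0.
  have := lu (l - e); rewrite lte_fin gtrBl e0 => /(_ isT) lue.
  near=> n; have : (u n <= l%:E)%E by near: n.
  have : ((l - e)%:E <= u n)%E by near: n.
  rewrite /=; case: (u n) => [r||] //=; rewrite !lee_fin => ? ?.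
  by rewrite ger0_norm; lra.
- apply/cvgeyPge => A; apply: lu; exact: ltry.
- apply/cvgeNyPle => A; near=> n.
  by apply: le_trans (leNye _); near: n.
Unshelve. all: by end_near. Qed.

Theorem theorem9 (R : realType) (N : nat) (p : 'I_N -> R)
  (hN : (1 <= N)%N) (hp : forall i : 'I_N, 0 < p i <= 1)
  (s : state N) (hs : in_S s)
  (sm : nat -> state N) (hsm : forall m : nat, (N.+1 <= m)%N -> in_Sm m (sm m)) :
  Vmstar m p (sm m) @[m --> \oo] --> Vstar p s.
Proof.
have upper m (g : R) : (N < m)%N -> (Vstar p s < g%:E)%E ->
    (Vmstar m p (sm m) <= g%:E)%E.
  move=> Nm sg.
  have [W HW] := supersolution_of_min_average_cost p hp id m g s (trunc_le m) hs sg.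
  exact: (Vmstar_le_of_supersolution p hp m g W _ Nm (hsm _ Nm) HW).
apply: cvg_ereal_between => [|r rV].
  exists N.+1 => // m /= Nm; rewrite leNgt; apply/negP => VV.
  have [g Vg gV] := ereal_dense_EFin _ _ _ VV.
  by have := upper _ _ Nm Vg; rewrite leNgt gV.
suff [M HM] : exists M, forall m, (M <= m)%N -> (r%:E <= Vmstar m p (sm m))%E by exists M.
apply: contrapT => often.
suff : forall n, exists W, supersolution p (n + N.+1) r W.
  move=> /choice[W HW].
  by have := Vstar_le_of_supersolutions p hp r s W hs HW; rewrite leNgt rV.
(* A value below [r] at any truncation [m >= n + N.+1] would already give a supersolution at level
   [n + N.+1]. *)
move=> n; apply: contrapT => noW; apply: often; exists (n + N.+1)%N => m nm.
rewrite leNgt; apply/negP => Vr; apply: noW.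
have Nm : (N < m)%N by lia.
apply: (supersolution_of_min_average_cost p hp (trunc m) _ _ (sm m)) Vr.
  by move=> x; rewrite /trunc; lia.
by have [] := hsm _ Nm.
Qed.
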